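(* Let $C_1\approx 0.9002270330$ and $C_2\approx 1.100851119$ be respectively the second largest root and the largest root of the polynomial $$6137x^5-14689x^4+14429x^3-9547x^2+3698x-100.$$ For every triangle, the following bounds hold, where a bound $L\le \frac{D(n,i)}{D(n,j)}\le U$ means $L\,D(n,j)\le D(n,i)\le U\,D(n,j)$ (and similarly for one-sided bounds and equalities): $$1\le\frac{D(3,1)}{D(3,2)}\le3,\quad \frac13\le\frac{D(3,1)}{D(3,4)}\le1,\quad \frac23\le\frac{D(3,1)}{D(3,5)}\le2,\quad \sqrt3-1\le\frac{D(3,1)}{D(3,6)}\le1,$$ $$\frac1{17}\left(7+4\sqrt2\right)\le\frac{D(3,1)}{D(3,7)}\le1,\quad 1\le\frac{D(3,1)}{D(3,8)},\quad 1\le\frac{D(3,1)}{D(3,9)},\quad 1\le\frac{D(3,1)}{D(3,10)},$$ $$\frac{D(3,2)}{D(3,4)}=\frac13,\quad \frac{D(3,2)}{D(3,5)}=\frac23,\quad \frac13\le\frac{D(3,2)}{D(3,6)}\le1,\quad \frac13\le\frac{D(3,2)}{D(3,7)}\le1,\quad \frac13\le\frac{D(3,2)}{D(3,8)},\quad 1\le\frac{D(3,2)}{D(3,9)},\quad 1\le\frac{D(3,2)}{D(3,10)},$$ $$\frac{D(3,4)}{D(3,5)}=2,\quad 1\le\frac{D(3,4)}{D(3,6)}\le3,\quad 1\le\frac{D(3,4)}{D(3,7)}\le3,\quad 1\le\frac{D(3,4)}{D(3,8)},\quad 3\le\frac{D(3,4)}{D(3,9)},\quad 3\le\frac{D(3,4)}{D(3,10)},$$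 $$\frac12\le\frac{D(3,5)}{D(3,6)}\le\frac32,\quad \frac12\le\frac{D(3,5)}{D(3,7)}\le\frac32,\quad \frac12\le\frac{D(3,5)}{D(3,8)},\quad \frac32\le\frac{D(3,5)}{D(3,9)},\quad \frac32\le\frac{D(3,5)}{D(3,10)},$$ $$C_1\le\frac{D(3,6)}{D(3,7)}\le C_2,\quad 1\le\frac{D(3,6)}{D(3,8)},\quad 1\le\frac{D(3,6)}{D(3,9)},\quad 1\le\frac{D(3,6)}{D(3,10)},$$ $$1\le\frac{D(3,7)}{D(3,8)},\quad 1\le\frac{D(3,7)}{D(3,9)},\quad 1\le\frac{D(3,7)}{D(3,10)},\quad \frac12\le\frac{D(3,9)}{D(3,10)}\le1.$$
   Context: For a (nondegenerate) triangle $ABC$ with side lengths $a=BC$, $b=CA$, $c=AB$, a point with barycentric coordinates $(u:v:w)$ is $(uA+vB+wC)/(u+v+w)$. For $1\le n\le 10$ the triangle center $X_n$ is the point with barycentric coordinates $(f_n(a,b,c):f_n(b,c,a):f_n(c,a,b))$, where $f_1=a$ (incenter); $f_2=1$ (centroid); $f_3=a^2(a^2-b^2-c^2)$ (circumcenter); $f_4=(a^2+b^2-c^2)(a^2-b^2+c^2)$ (orthocenter); $f_5=c^4-a^2b^2+b^4-a^2c^2-2b^2c^2$ (nine-point center); $f_6=a^2$ (symmedian point); $f_7=(a+b-c)(a-b+c)$ (Gergonne point); $f_8=a-b-c$ (Nagel point); $f_9=a(a-b-c)$ (mittenpunkt); $f_{10}=b+c$ (Spieker center). $D(i,j)$ denotes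 the Euclidean distance between $X_i$ and $X_j$. Roots of polynomials are real roots. *)

(* Defs.v *)
From Stdlib Require Import Reals Lra.
Open Scope R_scope.

Definition point : Type := (R * R)%type.

Definition dist (P Q : point) : R := dist_euc (fst P) (snd P) (fst Q) (snd Q).

(* The determinant is twice the signed area of ABC. *)
Definition nondegenerate (A B C : point) : Prop :=
  (fst B - fst A) * (snd C - snd A) - (fst C - fst A) * (snd B - snd A) <> 0.

Definition barycentric (A B C : point) (u v w : R) : point :=
  ((u * fst A + v * fst B + w * fst C) / (u + v + w),
   (u * snd A + v * snd B + w * snd C) / (u + v + w)).

(* First barycentric coordinate of X_n; n outside 1..10 is a dummy case. *)
Definition center_function (n : nat) (a b c : R) : R :=
  match n with
  | 1%nat => a                                         (* incenter *)
  | 2%nat => 1                                         (* centroid *)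
  | 3%nat => a ^ 2 * (a ^ 2 - b ^ 2 - c ^ 2)           (* circumcenter *)
  | 4%nat => (a ^ 2 + b ^ 2 - c ^ 2) * (a ^ 2 - b ^ 2 + c ^ 2)
                                                       (* orthocenter *)
  | 5%nat => c ^ 4 - a ^ 2 * b ^ 2 + b ^ 4 - a ^ 2 * c ^ 2
             - 2 * b ^ 2 * c ^ 2                       (* nine-point center *)
  | 6%nat => a ^ 2                                     (* symmedian point *)
  | 7%nat => (a + b - c) * (a - b + c)                 (* Gergonne point *)
  | 8%nat => a - b - c                                 (* Nagel point *)
  | 9%nat => a * (a - b - c)                           (* mittenpunkt *)
  | 10%nat => b + c                                    (* Spieker center *)
  | _ => 0
  end.

Definition X (A B C : point) (n : nat) : point :=
  let a := dist B C in
  let b := dist C A in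
  let c := dist A B in
  barycentric A B C
    (center_function n a b c) (center_function n b c a) (center_function n c a b).

Definition D (A B C : point) (i j : nat) : R := dist (X A B C i) (X A B C j).

Definition quintic (x : R) : R :=
  6137 * x ^ 5 - 14689 * x ^ 4 + 14429 * x ^ 3 - 9547 * x ^ 2 + 3698 * x - 100.

Definition is_largest_root (p : R -> R) (r : R) : Prop :=
  p r = 0 /\ forall s : R, p s = 0 -> s <= r.

(* Roots are ranked without multiplicity. *)
Definition is_second_largest_root (p : R -> R) (r : R) : Prop :=
  p r = 0 /\ exists! s : R, p s = 0 /\ r < s.

(* Main.v *)
Require Import Defs.
From Stdlib Require Import Reals Lra Psatz.
Open Scope R_scope.

(* In terms of the circumradius R, the inradius r and the semiperimeter s, all D(3,n)^2 are
   affine in t = s^2, except D(3,6)^2, which increases with t.  Normalise R = 1 and put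
   d = OI, so that r = (1 - d^2)/2.  Blundon's inequality (the discriminant of the cubic with
   roots a, b, c) confines t to the interval whose end points are the values of t at the
   isosceles triangles with the same d.  Every comparison is thus reduced to isosceles
   triangles, where all centers lie on one line and the ratios D(3,i)/D(3,j) are rational
   functions of the signed d in (-1,1).  C1 and C2 are the extreme values of such a
   function, and the quintic vanishes at its critical values. *)

Local Notation dist := Defs.dist.

(** * Distances from the circumcenter in barycentric coordinates *)

Lemma le_of_sub_nonneg (x y : R) : 0 <= y - x -> x <= y.
Proof. lra. Qed.

Lemma dist_nonneg (P Q : point) : 0 <= dist P Q.
Proof. unfold dist, dist_euc; apply sqrt_pos. Qed.

Lemma dist_sq (P Q : point) :
  dist P Q ^ 2 = (fst P - fst Q) ^ 2 + (snd P - snd Q) ^ 2.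
Proof.
  unfold dist, dist_euc. rewrite pow2_sqrt by (apply Rplus_le_le_0_compat; apply Rle_0_sqr).
  unfold Rsqr; ring.
Qed.

(** Lagrange's identity: expand the square of the vector u OA + v OB + w OC, with 2 OA.OB = OA^2 +
    OB^2 - AB^2 and likewise for the other pairs. *)
Lemma dist_barycentric (A B C O : point) (rho u v w : R) :
  dist O A ^ 2 = rho -> dist O B ^ 2 = rho -> dist O C ^ 2 = rho -> u + v + w <> 0 ->
  dist O (barycentric A B C u v w) ^ 2
  = rho - (dist B C ^ 2 * (v * w) + dist C A ^ 2 * (w * u) + dist A B ^ 2 * (u * v))
          / (u + v + w) ^ 2.
Proof.
  intros HA HB HC HS. rewrite !dist_sq in *.
  destruct A as [a1 a2], B as [b1 b2], C as [c1 c2], O as [o1 o2].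
  unfold barycentric; simpl fst in *; simpl snd in *.
  apply (Rmult_eq_reg_r ((u + v + w) ^ 2)); [| apply pow_nonzero; exact HS].
  transitivity ((u * (o1 - a1) + v * (o1 - b1) + w * (o1 - c1)) ^ 2
                + (u * (o2 - a2) + v * (o2 - b2) + w * (o2 - c2)) ^ 2);
    [field; exact HS |].
  transitivity (rho * (u + v + w) ^ 2
    - (((b1 - c1) ^ 2 + (b2 - c2) ^ 2) * (v * w) + ((c1 - a1) ^ 2 + (c2 - a2) ^ 2) * (w * u)
       + ((a1 - b1) ^ 2 + (a2 - b2) ^ 2) * (u * v))); [| field; exact HS].
  (* [E] isolates the deviations from [rho]. Once these vanish, rho (u + v + w)^2 can be traded for
     a polynomial in the coordinates, and [ring] concludes. *)
  assert (E : forall e1 e2 e3 : R,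
    u * (u + v + w) * e1 + v * (u + v + w) * e2 + w * (u + v + w) * e3
    = rho * (u + v + w) ^ 2 + u * (u + v + w) * (e1 - rho)
      + v * (u + v + w) * (e2 - rho) + w * (u + v + w) * (e3 - rho)) by (intros; ring).
  assert (E' := E ((o1 - a1) ^ 2 + (o2 - a2) ^ 2) ((o1 - b1) ^ 2 + (o2 - b2) ^ 2)
                  ((o1 - c1) ^ 2 + (o2 - c2) ^ 2)).
  rewrite HA, HB, HC in E' at 2. rewrite !Rminus_diag, !Rmult_0_r, !Rplus_0_r in E'.
  rewrite <- E'. ring.
Qed.

Definition det (A B C : point) : R :=
  (fst B - fst A) * (snd C - snd A) - (fst C - fst A) * (snd B - snd A).

(** [rho] is the square of the classical abc / (4 area), as [det] is twice the signed area. The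
    weights of X_3 add up to -4 det^2, so only rational identities in the coordinates remain. *)
Lemma dist_X3_vertices (A B C : point) : nondegenerate A B C ->
  let rho := (dist B C * dist C A * dist A B) ^ 2 / (4 * det A B C ^ 2) in
  dist (X A B C 3) A ^ 2 = rho /\ dist (X A B C 3) B ^ 2 = rho /\ dist (X A B C 3) C ^ 2 = rho.
Proof.
  intros H rho. unfold nondegenerate in H. fold (det A B C) in H.
  unfold rho; clear rho.
  rewrite 2!Rpow_mult_distr.
  unfold X, barycentric, center_function.
  rewrite !(dist_sq (_, _)), !dist_sq.
  unfold det in *.
  destruct A as [a1 a2], B as [b1 b2], C as [c1 c2]; cbn [fst snd] in *.
  match goal with |- context [_ / (?x + ?y + ?z) - a1] => set (S := x + y + z) end.
  assert (HS : S = -4 * ((b1 - a1) * (c2 - a2) - (c1 - a1) * (b2 - a2)) ^ 2)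
    by (unfold S; ring).
  rewrite HS; clear S HS.
  repeat split; field; exact H.
Qed.

Lemma dist_pos (A B : point) : fst A <> fst B \/ snd A <> snd B -> 0 < dist A B.
Proof.
  intros H. destruct (Rle_lt_or_eq_dec _ _ (dist_nonneg A B)) as [h | h]; [exact h | exfalso].
  assert (E := dist_sq A B). rewrite <- h in E.
  destruct (Rplus_sqr_eq_0 (fst A - fst B) (snd A - snd B)) as [e e'];
    [unfold Rsqr; lra |].
  destruct H as [H | H]; apply H; lra.
Qed.

Lemma nondegenerate_sides (A B C : point) : nondegenerate A B C ->
  0 < dist B C /\ 0 < dist C A /\ 0 < dist A B.
Proof.
  unfold nondegenerate; intros H.
  destruct A as [a1 a2], B as [b1 b2], C as [c1 c2]; simpl in H.
  repeat split; apply dist_pos; simpl;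
    match goal with |- ?x <> ?y \/ ?z <> ?w => 
      destruct (Req_dec x y) as [e | e]; [right; intros e' | left; exact e];
      apply H; rewrite e, e'; ring end.
Qed.

(** * Circumradius, inradius and semiperimeter *)

Lemma heron (A B C : point) :
  let a := dist B C in let b := dist C A in let c := dist A B in
  4 * det A B C ^ 2 = (a + b + c) * (b + c - a) * (c + a - b) * (a + b - c).
Proof.
  intros a b c.
  (* Only even powers of the sides occur here, so no square root survives. *)
  transitivity (2 * (a ^ 2 * b ^ 2 + b ^ 2 * c ^ 2 + c ^ 2 * a ^ 2)
                - (a ^ 2) ^ 2 - (b ^ 2) ^ 2 - (c ^ 2) ^ 2); [| ring].
  unfold a, b, c; rewrite !dist_sq; unfold det; ring.
Qed.

(** The equations give the elementary symmetric functions of the sides, so every symmetric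
    polynomial in the sides becomes one in [Rc], [r], [s]. *)
Definition has_radii (a b c Rc r s : R) : Prop :=
  0 < Rc /\ 0 < r /\ 0 < s /\ a + b + c = 2 * s /\
  a * b + b * c + c * a = s ^ 2 + r ^ 2 + 4 * Rc * r /\ a * b * c = 4 * Rc * r * s.

Lemma radii_exist (A B C : point) : nondegenerate A B C ->
  exists Rc r s : R,
    has_radii (dist B C) (dist C A) (dist A B) Rc r s /\
    forall u v w : R, u + v + w <> 0 ->
      dist (X A B C 3) (barycentric A B C u v w) ^ 2
      = Rc ^ 2 - (dist B C ^ 2 * (v * w) + dist C A ^ 2 * (w * u) + dist A B ^ 2 * (u * v))
                / (u + v + w) ^ 2.
Proof.
  intros H.
  destruct (nondegenerate_sides A B C H) as (ha & hb & hc).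
  destruct (dist_X3_vertices A B C H) as (HA & HB & HC).
  assert (Hh := heron A B C). cbv zeta in Hh.
  assert (HT : 0 < Rabs (det A B C)) by (apply Rabs_pos_lt; exact H).
  rewrite <- (pow2_abs (det A B C)) in *.
  set (T := Rabs (det A B C)) in *. clearbody T.
  set (a := dist B C) in *; set (b := dist C A) in *; set (c := dist A B) in *.
  (* [T] is twice the area: the witnesses are abc / (4 area), area / s and half the perimeter. *)
  exists (a * b * c / (2 * T)), (T / (a + b + c)), ((a + b + c) / 2).
  split.
  - unfold has_radii. repeat split.
    + apply Rdiv_lt_0_compat; [repeat apply Rmult_lt_0_compat |]; lra.
    + apply Rdiv_lt_0_compat; lra.
    + lra.
    + field.
    + apply (Rmult_eq_reg_r (4 * (a + b + c) ^ 2)); [| apply Rgt_not_eq; nra].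
      transitivity ((a + b + c) ^ 4 + 4 * T ^ 2 + 8 * (a * b * c) * (a + b + c));
        [rewrite Hh; ring | field; lra].
    + field; lra.
  - intros u v w HS.
    replace ((a * b * c / (2 * T)) ^ 2) with ((a * b * c) ^ 2 / (4 * T ^ 2)) by (field; lra).
    apply dist_barycentric; assumption.
Qed.

(** * Squared distances of the centers in terms of R, r and s *)

(* Squared distance from the circumcenter, with [t] the squared semiperimeter. *)
Definition sqOX (n : nat) (Rc r t : R) : R :=
  match n with
  | 1%nat => Rc ^ 2 - 2 * Rc * r
  | 2%nat => Rc ^ 2 - 2 * (t - r ^ 2 - 4 * Rc * r) / 9
  | 4%nat => 9 * Rc ^ 2 - 2 * (t - r ^ 2 - 4 * Rc * r)
  | 5%nat => (9 * Rc ^ 2 - 2 * (t - r ^ 2 - 4 * Rc * r)) / 4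
  | 6%nat => Rc ^ 2 - 12 * Rc ^ 2 * r ^ 2 * t / (t - r ^ 2 - 4 * Rc * r) ^ 2
  | 7%nat => Rc ^ 2 - 4 * r * (Rc + r) * t / (4 * Rc + r) ^ 2
  | 8%nat => (Rc - 2 * r) ^ 2
  | 9%nat => Rc ^ 2 - 2 * Rc * (2 * Rc - r) * t / (4 * Rc + r) ^ 2
  | 10%nat => Rc ^ 2 - (t - 3 * r ^ 2 - 4 * Rc * r) / 4
  | _ => 0
  end.

Definition listed (n : nat) : Prop := (1 <= n <= 10)%nat /\ n <> 3%nat.

Lemma sum_sq_sides (a b c Rc r s : R) : has_radii a b c Rc r s ->
  a ^ 2 + b ^ 2 + c ^ 2 = 2 * (s ^ 2 - r ^ 2 - 4 * Rc * r).
Proof.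
  intros (_ & _ & _ & e1 & e2 & _).
  transitivity ((a + b + c) ^ 2 - 2 * (a * b + b * c + c * a)); [ring |].
  rewrite e1, e2; ring.
Qed.

Lemma sum_sq_sides_pos (a b c Rc r s : R) : has_radii a b c Rc r s ->
  0 < s ^ 2 - r ^ 2 - 4 * Rc * r.
Proof.
  intros H. assert (E := sum_sq_sides _ _ _ _ _ _ H).
  destruct H as (_ & _ & hs & e1 & _).
  assert (h : 0 < (a + b + c) ^ 2) by (rewrite e1; nra).
  assert (h1 := pow2_ge_0 (a - b)). assert (h2 := pow2_ge_0 (b - c)).
  assert (h3 := pow2_ge_0 (c - a)). lra.
Qed.

(** The sum of the weights and the numerator are symmetric in the sides. [Hred] lets each center
    supply closed forms [S] and [W] for them, after which [field] applies. *)
Lemma power_of_center (n : nat) (a b c Rc r s : R) :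
  listed n -> has_radii a b c Rc r s ->
  let u := center_function n a b c in
  let v := center_function n b c a in
  let w := center_function n c a b in
  u + v + w <> 0 /\
  Rc ^ 2 - (a ^ 2 * (v * w) + b ^ 2 * (w * u) + c ^ 2 * (u * v)) / (u + v + w) ^ 2
  = sqOX n Rc r (s ^ 2).
Proof.
  intros [Hn Hn3] H u v w.
  assert (Hpos := sum_sq_sides_pos _ _ _ _ _ _ H).
  assert (Hf := sum_sq_sides _ _ _ _ _ _ H).
  destruct H as (hR & hr & hs & e1 & e2 & e3).
  assert (Hred : forall S W : R, S <> 0 -> u + v + w = S ->
    a ^ 2 * (v * w) + b ^ 2 * (w * u) + c ^ 2 * (u * v) = W ->
    Rc ^ 2 - W / S ^ 2 = sqOX n Rc r (s ^ 2) ->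
    u + v + w <> 0 /\
    Rc ^ 2 - (a ^ 2 * (v * w) + b ^ 2 * (w * u) + c ^ 2 * (u * v)) / (u + v + w) ^ 2
    = sqOX n Rc r (s ^ 2)) by (intros S W H0 -> -> HH; split; assumption).
  assert (hrs : 0 < r * s) by (apply Rmult_lt_0_compat; assumption).
  assert (hR4 : 0 < 4 * Rc + r) by lra.
  assert (f2 : a ^ 2 * b ^ 2 + b ^ 2 * c ^ 2 + c ^ 2 * a ^ 2
               = (s ^ 2 + r ^ 2 + 4 * Rc * r) ^ 2 - 16 * Rc * r * s ^ 2).
  { transitivity ((a * b + b * c + c * a) ^ 2 - 2 * (a * b * c) * (a + b + c)); [ring |].
    rewrite e1, e2, e3; ring. }
  assert (f3 : a ^ 2 * b ^ 2 * c ^ 2 = 16 * Rc ^ 2 * r ^ 2 * s ^ 2).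
  { transitivity ((a * b * c) ^ 2); [ring | rewrite e3; ring]. }
  assert (p3 : a ^ 3 + b ^ 3 + c ^ 3 = 2 * s * (s ^ 2 - 3 * r ^ 2 - 6 * Rc * r)).
  { transitivity ((a + b + c) ^ 3 - 3 * (a + b + c) * (a * b + b * c + c * a)
                  + 3 * (a * b * c)); [ring |]. rewrite e1, e2, e3; ring. }
  unfold u, v, w in *; clear u v w.
  destruct n as [| [| [| [| [| [| [| [| [| [| [| n]]]]]]]]]]]; try lia;
    unfold center_function in *.
  - apply (Hred (2 * s) (8 * Rc * r * s ^ 2)).
    + lra.
    + exact e1.
    + transitivity (a * b * c * (a + b + c)); [ring | rewrite e1, e3; ring].
    + unfold sqOX; field; lra.
  - apply (Hred 3 (2 * (s ^ 2 - r ^ 2 - 4 * Rc * r))); try lra.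
    unfold sqOX; field.
  - apply (Hred (16 * (r * s) ^ 2)
      (16 * (r * s) ^ 2 * (2 * (s ^ 2 - r ^ 2 - 4 * Rc * r) * (16 * (r * s) ^ 2)
       - 128 * Rc ^ 2 * r ^ 2 * s ^ 2))).
    + nra.
    + transitivity (4 * (a ^ 2 * b ^ 2 + b ^ 2 * c ^ 2 + c ^ 2 * a ^ 2)
                    - (a ^ 2 + b ^ 2 + c ^ 2) ^ 2); [ring | rewrite f2, Hf; ring].
    + set (K := 4 * (a ^ 2 * b ^ 2 + b ^ 2 * c ^ 2 + c ^ 2 * a ^ 2)
                    - (a ^ 2 + b ^ 2 + c ^ 2) ^ 2).
      transitivity (K * ((a ^ 2 + b ^ 2 + c ^ 2) * K - 8 * (a ^ 2 * b ^ 2 * c ^ 2)));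
        [unfold K; ring |].
      unfold K; rewrite f2, Hf, f3; ring.
    + unfold sqOX; field; lra.
  - apply (Hred (-32 * (r * s) ^ 2)
      (16 * (r * s) ^ 2 * (2 * (s ^ 2 - r ^ 2 - 4 * Rc * r) * (16 * (r * s) ^ 2)
       - 80 * Rc ^ 2 * r ^ 2 * s ^ 2))).
    + nra.
    + transitivity (-2 * (4 * (a ^ 2 * b ^ 2 + b ^ 2 * c ^ 2 + c ^ 2 * a ^ 2)
                    - (a ^ 2 + b ^ 2 + c ^ 2) ^ 2)); [ring | rewrite f2, Hf; ring].
    + set (K := 4 * (a ^ 2 * b ^ 2 + b ^ 2 * c ^ 2 + c ^ 2 * a ^ 2)
                    - (a ^ 2 + b ^ 2 + c ^ 2) ^ 2).
      transitivity (K * ((a ^ 2 + b ^ 2 + c ^ 2) * K - 5 * (a ^ 2 * b ^ 2 * c ^ 2)));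
        [unfold K; ring |].
      unfold K; rewrite f2, Hf, f3; ring.
    + unfold sqOX; field; lra.
  - apply (Hred (2 * (s ^ 2 - r ^ 2 - 4 * Rc * r)) (48 * Rc ^ 2 * r ^ 2 * s ^ 2)).
    + lra.
    + exact Hf.
    + transitivity (3 * (a ^ 2 * b ^ 2 * c ^ 2)); [ring | rewrite f3; ring].
    + unfold sqOX; field; lra.
  - apply (Hred (4 * r * (4 * Rc + r)) (64 * r ^ 3 * s ^ 2 * (Rc + r))).
    + nra.
    + transitivity (4 * (a * b + b * c + c * a) - (a + b + c) ^ 2); [ring |].
      rewrite e1, e2; ring.
    + transitivity (((a + b + c) * (4 * (a * b + b * c + c * a) - (a + b + c) ^ 2)
                     - 8 * (a * b * c))
                    * ((a + b + c) * (a ^ 2 + b ^ 2 + c ^ 2) - 2 * (a ^ 3 + b ^ 3 + c ^ 3)));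
        [ring | rewrite Hf, p3, e1, e2, e3; ring].
    + unfold sqOX; field; lra.
  - apply (Hred (-2 * s) (16 * s ^ 2 * r * (Rc - r))).
    + lra.
    + transitivity (- (a + b + c)); [ring | rewrite e1; ring].
    + transitivity ((a ^ 2 + b ^ 2 + c ^ 2) ^ 2
        - 2 * (a ^ 2 * b ^ 2 + b ^ 2 * c ^ 2 + c ^ 2 * a ^ 2) * 2
        + 2 * (a * b * c) * (a + b + c)); [ring |].
      rewrite Hf, f2, e1, e3; ring.
    + unfold sqOX; field; lra.
  - apply (Hred (-4 * r * (4 * Rc + r)) (32 * Rc * r ^ 2 * s ^ 2 * (2 * Rc - r))).
    + nra.
    + transitivity ((a + b + c) ^ 2 - 4 * (a * b + b * c + c * a)); [ring |].
      rewrite e1, e2; ring.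
    + transitivity (a * b * c * (2 * (a ^ 3 + b ^ 3 + c ^ 3)
          - (a + b + c) * (a ^ 2 + b ^ 2 + c ^ 2) + 6 * (a * b * c)));
        [ring | rewrite Hf, p3, e1, e3; ring].
    + unfold sqOX; field; lra.
  - apply (Hred (4 * s) (4 * s ^ 2 * (s ^ 2 - 3 * r ^ 2 - 4 * Rc * r))).
    + lra.
    + transitivity (2 * (a + b + c)); [ring | rewrite e1; ring].
    + transitivity ((a + b + c) * (a ^ 3 + b ^ 3 + c ^ 3 + a * b * c));
        [ring | rewrite e1, p3, e3; ring].
    + unfold sqOX; field; lra.
Qed.

(** * Blundon's inequality and normalisation to circumradius 1 *)

Lemma blundon (a b c Rc r s : R) : has_radii a b c Rc r s ->
  (s ^ 2) ^ 2 - 2 * (2 * Rc ^ 2 + 10 * Rc * r - r ^ 2) * s ^ 2 + r * (4 * Rc + r) ^ 3 <= 0.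
Proof.
  intros (_ & hr & _ & e1 & e2 & e3).
  (* The left side is the discriminant of the cubic with roots a, b, c; being a square, it fixes the
     sign of the other factor. *)
  assert (E : ((a - b) * (b - c) * (c - a)) ^ 2
    = -4 * r ^ 2 * ((s ^ 2) ^ 2 - 2 * (2 * Rc ^ 2 + 10 * Rc * r - r ^ 2) * s ^ 2
                    + r * (4 * Rc + r) ^ 3)).
  { transitivity ((a + b + c) ^ 2 * (a * b + b * c + c * a) ^ 2
      - 4 * (a * b + b * c + c * a) ^ 3 - 4 * (a + b + c) ^ 3 * (a * b * c)
      + 18 * (a + b + c) * (a * b + b * c + c * a) * (a * b * c)
      - 27 * (a * b * c) ^ 2); [ring |].
    rewrite e1, e2, e3; ring. }
  assert (h := pow2_ge_0 ((a - b) * (b - c) * (c - a))).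
  assert (hr2 : 0 < r ^ 2) by nra.
  rewrite E in h. nra.
Qed.

(** Euler's relation OI^2 = R^2 - 2 R r with R = 1 and OI = d gives the inradius (1 - d^2) / 2. *)
Definition nsq (n : nat) (d t : R) : R := sqOX n 1 ((1 - d ^ 2) / 2) t.

(* Squared semiperimeter of the isosceles triangle with [R = 1] whose incenter lies at
   signed distance [x] from the circumcenter in the direction of the apex. *)
Definition iso (x : R) : R := (3 - x) ^ 3 * (1 + x) / 4.

Lemma normalisation (A B C : point) : nondegenerate A B C ->
  exists Rc d t : R, 0 < Rc /\ 0 <= d < 1 /\ iso (- d) <= t <= iso d /\
    forall n : nat, listed n -> D A B C 3 n ^ 2 = Rc ^ 2 * nsq n d t.
Proof.
  intros H. destruct (radii_exist A B C H) as (Rc & r & s & Hrad & Hdist).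
  assert (HD : forall n : nat, listed n -> D A B C 3 n ^ 2 = sqOX n Rc r (s ^ 2)).
  { intros n Hn. destruct (power_of_center n _ _ _ _ _ _ Hn Hrad) as [HS <-].
    apply (Hdist _ _ _ HS). }
  assert (Hbl := blundon _ _ _ _ _ _ Hrad).
  assert (Hpos := sum_sq_sides_pos _ _ _ _ _ _ Hrad).
  destruct Hrad as (hR & hr & hs & _).
  assert (HI : D A B C 3 1 ^ 2 = Rc ^ 2 - 2 * Rc * r) by (apply (HD 1%nat); split; lia).
  assert (HD0 : 0 <= D A B C 3 1) by apply dist_nonneg.
  set (d := D A B C 3 1 / Rc). set (t := s ^ 2 / Rc ^ 2).
  assert (Hd : D A B C 3 1 = d * Rc) by (unfold d; field; lra).
  assert (Ht : s ^ 2 = t * Rc ^ 2) by (unfold t; field; lra).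
  assert (Hd0 : 0 <= d) by (apply Rle_mult_inv_pos; assumption).
  rewrite Hd in HI. clearbody d t.
  assert (Hr : r = Rc * ((1 - d ^ 2) / 2)).
  { apply (Rmult_eq_reg_l (2 * Rc)); [| lra]. nra. }
  exists Rc, d, t. split; [exact hR |].
  assert (Hd1 : d < 1) by nra.
  split; [split; assumption |]. split.
  - rewrite Hr, Ht in Hbl.
    (* Up to the factor Rc^4 this product is Blundon's quadratic; the gap 4 d^3 then orders its two
       roots. *)
    assert (Hq : (t - iso (- d)) * (t - iso d) <= 0).
    { apply (Rmult_le_reg_l (Rc ^ 4)); [apply pow_lt; exact hR |].
      rewrite Rmult_0_r. eapply Rle_trans; [| exact Hbl]. right; unfold iso; field. }
    assert (Hi : iso d - iso (- d) = 4 * d ^ 3) by (unfold iso; field).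
    assert (0 <= d ^ 3) by (apply pow_le; exact Hd0).
    split; nra.
  - intros n Hn. rewrite (HD n Hn), Ht, Hr. rewrite Ht, Hr in Hpos.
    (* This keeps the symmedian denominator nonzero for [field]. *)
    assert (Hpos' : 0 < t - ((1 - d ^ 2) / 2) ^ 2 - 4 * ((1 - d ^ 2) / 2)).
    { apply (Rmult_lt_reg_l (Rc ^ 2)); [apply pow_lt; exact hR |]. nra. }
    destruct Hn as [Hn Hn3].
    unfold nsq.
    destruct n as [| [| [| [| [| [| [| [| [| [| [| n]]]]]]]]]]]; try lia;
      unfold sqOX; field; try (repeat split; nra).
Qed.

(** * Isosceles triangles, and the dependence on t *)

(* At [t = iso x] the centers lie on the axis of symmetry, [X_n] at signed distance
   [x * sigma n x] from the circumcenter. *)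
Definition sigma (n : nat) (x : R) : R :=
  match n with
  | 1%nat => 1
  | 2%nat => (2 - x) / 3
  | 6%nat => 2 * (2 - x) / (3 - 2 * x + x ^ 2)
  | 7%nat => (4 + x - x ^ 2) / (3 + x)
  | 9%nat => (1 - x) / (3 + x)
  | 10%nat => (1 - x) / 2
  | _ => 0
  end.

(** X_4 and X_5 are left to [euler_line], X_8 to [D_1_8]; X_6 is not affine in t. *)
Definition affine_index (n : nat) : Prop :=
  n = 1%nat \/ n = 2%nat \/ n = 7%nat \/ n = 9%nat \/ n = 10%nat.
(** These are the centers compared directly with X_6, where the sign of the slope in t matters. *)
Definition decreasing_index (n : nat) : Prop := n = 1%nat \/ n = 2%nat \/ n = 7%nat.

Lemma sigma6_denominator_pos (x : R) : 0 < 3 - 2 * x + x ^ 2.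
Proof. assert (h := pow2_ge_0 (1 - x)). lra. Qed.

Lemma nsq_iso (n : nat) (x : R) : affine_index n \/ n = 6%nat -> -1 < x < 1 ->
  nsq n x (iso x) = (x * sigma n x) ^ 2.
Proof.
  intros Hn Hx.
  destruct Hn as [[-> | [-> | [-> | [-> | ->]]]] | ->]; unfold nsq, sqOX, iso, sigma;
    field; repeat split; try nra.
  (* The denominator left over, for X_6, is a positive multiple of iso x - r^2 - 4 r. *)
  apply Rgt_not_eq.
  replace (_ - _) with (4 * ((2 + (1 - x) ^ 2) * ((3 - x) * (1 + x)))) by ring.
  assert (h := pow2_ge_0 (1 - x)).
  repeat apply Rmult_lt_0_compat; lra.
Qed.

Lemma sigma_nonneg (n : nat) (x : R) : affine_index n \/ n = 6%nat -> -1 < x < 1 ->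
  0 <= sigma n x.
Proof.
  intros Hn Hx.
  destruct Hn as [[-> | [-> | [-> | [-> | ->]]]] | ->]; unfold sigma; try lra;
    apply Rle_mult_inv_pos; nra.
Qed.

Lemma nsq_opp (n : nat) (d t : R) : nsq n (- d) t = nsq n d t.
Proof. unfold nsq; replace ((- d) ^ 2) with (d ^ 2) by ring; reflexivity. Qed.

Lemma nsq_affine (n : nat) (d : R) : affine_index n -> -1 < d < 1 ->
  exists p q : R, (forall t : R, nsq n d t = p + q * t) /\ (decreasing_index n -> q <= 0).
Proof.
  intros Hn Hd.
  assert (hr : 0 < (1 - d ^ 2) / 2) by nra.
  unfold nsq; set (r := (1 - d ^ 2) / 2) in *; clearbody r.
  destruct Hn as [-> | [-> | [-> | [-> | ->]]]]; unfold sqOX.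
  - exists (1 ^ 2 - 2 * 1 * r), 0. split; [intros; ring | lra].
  - exists (1 - 2 * (- r ^ 2 - 4 * 1 * r) / 9), (-2 / 9). split; [intros; field | lra].
  - exists 1, (- (4 * r * (1 + r) / (4 * 1 + r) ^ 2)). split; [intros; field; lra |].
    intros _. assert (0 <= 4 * r * (1 + r) / (4 * 1 + r) ^ 2); [| lra].
    apply Rle_mult_inv_pos; nra.
  - exists 1, (- (2 * 1 * (2 * 1 - r) / (4 * 1 + r) ^ 2)).
    split; [intros; field; lra | intros [e | [e | e]]; discriminate e].
  - exists (1 - (- 3 * r ^ 2 - 4 * 1 * r) / 4), (-1 / 4).
    split; [intros; field | lra].
Qed.

(** With m = r^2 + 4 r, the function t / (t - m)^2 decreases for t > m: its drop from t1 to t2 has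
    the sign of (t2 - t1)(t1 t2 - m^2). Both [iso d] and [iso (- d)] exceed m, so either one below
    [t1] suffices. *)
Lemma nsq6_increasing (d t1 t2 : R) : -1 < d < 1 -> iso d <= t1 \/ iso (- d) <= t1 ->
  t1 <= t2 -> nsq 6 d t1 <= nsq 6 d t2.
Proof.
  intros Hd Ht1 Ht2.
  unfold nsq, sqOX.
  set (m := ((1 - d ^ 2) / 2) ^ 2 + 4 * ((1 - d ^ 2) / 2)).
  assert (Hr : 0 <= (1 - d ^ 2) / 2) by nra.
  assert (Hm : 0 <= m) by (unfold m; nra).
  assert (Hm1 : m < t1).
  { assert (H0 : forall x : R, -1 < x < 1 ->
      ((1 - x ^ 2) / 2) ^ 2 + 4 * ((1 - x ^ 2) / 2) < iso x).
    { intros x Hx. apply Rlt_0_minus. unfold iso.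
      replace (_ - _) with (/ 2 * ((2 + (1 - x) ^ 2) * ((3 - x) * (1 + x)))) by field.
      assert (h := pow2_ge_0 (1 - x)).
      repeat apply Rmult_lt_0_compat; lra. }
    destruct Ht1 as [Ht1 | Ht1].
    - assert (h := H0 d Hd). unfold m; lra.
    - assert (h := H0 (- d)). replace ((- d) ^ 2) with (d ^ 2) in h by ring.
      fold m in h. lra. }
  replace (t1 - ((1 - d ^ 2) / 2) ^ 2 - 4 * 1 * ((1 - d ^ 2) / 2)) with (t1 - m)
    by (unfold m; ring).
  replace (t2 - ((1 - d ^ 2) / 2) ^ 2 - 4 * 1 * ((1 - d ^ 2) / 2)) with (t2 - m)
    by (unfold m; ring).
  set (r := (1 - d ^ 2) / 2) in *. clearbody m r.
  apply le_of_sub_nonneg.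
  replace (_ - _) with
    (12 * r ^ 2 * ((t2 - t1) * (t1 * t2 - m ^ 2)) * / ((t1 - m) ^ 2 * (t2 - m) ^ 2))
    by (field; lra).
  apply Rle_mult_inv_pos.
  - apply Rmult_le_pos; [nra |]. apply Rmult_le_pos; nra.
  - apply Rmult_lt_0_compat; apply pow_lt; lra.
Qed.

(** * Reduction of the comparisons to isosceles triangles *)

Lemma nsq_compare_iso (k : R) (i j : nat) : 0 <= k ->
  affine_index i \/ i = 6%nat -> affine_index j \/ j = 6%nat ->
  (forall x : R, -1 < x < 1 -> k * sigma i x <= sigma j x) ->
  forall x d : R, x = d \/ x = - d -> -1 < d < 1 ->
  k ^ 2 * nsq i d (iso x) <= nsq j d (iso x).
Proof.
  intros Hk Hi Hj H x d Hxd Hd.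
  assert (Hx : -1 < x < 1) by lra.
  assert (E : forall n : nat, nsq n d (iso x) = nsq n x (iso x)).
  { intros n; destruct Hxd as [-> | ->]; [reflexivity | symmetry; apply nsq_opp]. }
  rewrite !E, !nsq_iso by assumption.
  assert (h := H x Hx). assert (h0 := sigma_nonneg i x Hi Hx).
  assert (h1 : (k * sigma i x) ^ 2 <= sigma j x ^ 2).
  { apply pow_incr; split; [apply Rmult_le_pos; assumption | exact h]. }
  assert (h2 := pow2_ge_0 x).
  replace (k ^ 2 * (x * sigma i x) ^ 2) with (x ^ 2 * (k * sigma i x) ^ 2) by ring.
  rewrite (Rpow_mult_distr x). apply Rmult_le_compat_l; assumption.
Qed.

(** An affine difference is nonnegative once it is so at both end points. Against X_6 the other side
    is nonincreasing, so the difference is monotone and one end point decides: [iso d] if X_6 is on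
    the smaller side, [iso (- d)] if on the larger. *)
Lemma nsq_compare (k : R) (i j : nat) : 0 <= k ->
  (affine_index i /\ affine_index j) \/ (i = 6%nat /\ decreasing_index j)
    \/ (decreasing_index i /\ j = 6%nat) ->
  (forall x : R, -1 < x < 1 -> k * sigma i x <= sigma j x) ->
  forall d t : R, 0 <= d < 1 -> iso (- d) <= t <= iso d -> k ^ 2 * nsq i d t <= nsq j d t.
Proof.
  intros Hk Hij H d t Hd Ht.
  assert (Hd' : -1 < d < 1) by lra.
  assert (Hda : forall n : nat, decreasing_index n -> affine_index n)
    by (unfold decreasing_index, affine_index; tauto).
  assert (Hk2 := pow2_ge_0 k).
  assert (Hi : affine_index i \/ i = 6%nat) by (destruct Hij as [[] | [[] | []]]; auto).
  assert (Hj : affine_index j \/ j = 6%nat) by (destruct Hij as [[] | [[] | []]]; auto).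
  assert (Htop := nsq_compare_iso k i j Hk Hi Hj H d d (or_introl eq_refl) Hd').
  assert (Hbot := nsq_compare_iso k i j Hk Hi Hj H (- d) d (or_intror eq_refl) Hd').
  destruct Hij as [[Ai Aj] | [[-> Dj] | [Di ->]]].
  - destruct (nsq_affine i d Ai Hd') as (p & q & Ei & _).
    destruct (nsq_affine j d Aj Hd') as (p' & q' & Ej & _).
    rewrite !Ei, !Ej in *.
    destruct (Rle_dec 0 (q' - k ^ 2 * q)) as [h | h]; nra.
  - destruct (nsq_affine j d (Hda j Dj) Hd') as (p & q & Ej & Hq).
    assert (h := nsq6_increasing d t (iso d) Hd' (or_intror (proj1 Ht)) (proj2 Ht)).
    rewrite !Ej in *. specialize (Hq Dj).
    assert (k ^ 2 * nsq 6 d t <= k ^ 2 * nsq 6 d (iso d)) by (apply Rmult_le_compat_l; assumption).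
    nra.
  - destruct (nsq_affine i d (Hda i Di) Hd') as (p & q & Ei & Hq).
    assert (h := nsq6_increasing d (iso (- d)) t Hd' (or_intror (Rle_refl _)) (proj1 Ht)).
    rewrite !Ei in *. specialize (Hq Di).
    assert (k ^ 2 * (q * t) <= k ^ 2 * (q * iso (- d))) by (apply Rmult_le_compat_l; nra).
    nra.
Qed.

Lemma D_compare_of_nsq (k : R) (i j : nat) : 0 <= k -> listed i -> listed j ->
  (forall d t : R, 0 <= d < 1 -> iso (- d) <= t <= iso d -> k ^ 2 * nsq i d t <= nsq j d t) ->
  forall A B C : point, nondegenerate A B C -> k * D A B C 3 i <= D A B C 3 j.
Proof.
  intros Hk Hi Hj H A B C HT.
  destruct (normalisation A B C HT) as (Rc & d & t & hR & Hd & Ht & HD).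
  apply Rsqr_incr_0_var; [| apply dist_nonneg].
  rewrite !Rsqr_pow2, Rpow_mult_distr, !HD by assumption.
  replace (k ^ 2 * (Rc ^ 2 * nsq i d t)) with (Rc ^ 2 * (k ^ 2 * nsq i d t)) by ring.
  apply Rmult_le_compat_l; [apply pow2_ge_0 | exact (H d t Hd Ht)].
Qed.

Lemma D_compare (k : R) (i j : nat) : 0 <= k ->
  (affine_index i /\ affine_index j) \/ (i = 6%nat /\ decreasing_index j)
    \/ (decreasing_index i /\ j = 6%nat) ->
  (forall x : R, -1 < x < 1 -> k * sigma i x <= sigma j x) ->
  forall A B C : point, nondegenerate A B C -> k * D A B C 3 i <= D A B C 3 j.
Proof.
  intros Hk Hij H.
  assert (Hl : listed i /\ listed j).
  { unfold affine_index, decreasing_index, listed in *. lia. }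
  apply D_compare_of_nsq; try tauto. apply nsq_compare; assumption.
Qed.

(** * Bounds with rational or quadratic constants *)

Lemma D_1_8 (A B C : point) : nondegenerate A B C -> 1 * D A B C 3 8 <= D A B C 3 1.
Proof.
  apply D_compare_of_nsq; [lra | split; lia | split; lia |].
  intros d t Hd _. unfold nsq, sqOX.
  (* For R = 1 the Nagel distance is 1 - 2 r = d^2, against OI = d. *)
  replace (1 ^ 2 * _) with (d ^ 2 * d ^ 2) by field.
  replace (1 ^ 2 - _) with (d ^ 2) by field.
  assert (h : 0 <= d ^ 2 <= 1) by nra. nra.
Qed.

Lemma euler_line (A B C : point) : nondegenerate A B C ->
  D A B C 3 2 = 1 / 3 * D A B C 3 4 /\ D A B C 3 4 = 2 * D A B C 3 5.
Proof.
  intros H.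
  destruct (normalisation A B C H) as (Rc & d & t & _ & _ & _ & HD).
  assert (h2 : 0 <= D A B C 3 2) by apply dist_nonneg.
  assert (h4 : 0 <= D A B C 3 4) by apply dist_nonneg.
  assert (h5 : 0 <= D A B C 3 5) by apply dist_nonneg.
  split; apply Rsqr_inj; try lra; rewrite !Rsqr_pow2, !Rpow_mult_distr, !HD by (split; lia);
    unfold nsq, sqOX; field.
Qed.

Lemma centroid_bounds (A B C : point) : nondegenerate A B C ->
  1 * D A B C 3 2 <= D A B C 3 1 /\ 1 / 3 * D A B C 3 1 <= D A B C 3 2 /\
  1 / 3 * D A B C 3 6 <= D A B C 3 2 /\ 1 / 3 * D A B C 3 7 <= D A B C 3 2 /\
  1 * D A B C 3 10 <= D A B C 3 2.
Proof.
  intros H.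
  repeat split; apply D_compare; try exact H; try lra;
    try (unfold affine_index, decreasing_index; tauto);
    intros x Hx; assert (h6 := sigma6_denominator_pos x); unfold sigma; try lra; apply le_of_sub_nonneg.
  (* The comparisons with X_1 and X_10 were linear in x; those with X_6 and X_7 remain. *)
  - replace (_ - _) with ((2 - x) * (1 - x) ^ 2 / (3 * (3 - 2 * x + x ^ 2))) by (field; lra).
    apply Rle_mult_inv_pos; [apply Rmult_le_pos; [lra | apply pow2_ge_0] | lra].
  - replace (_ - _) with (2 * (1 - x) / (3 * (3 + x))) by (field; lra).
    apply Rle_mult_inv_pos; lra.
Qed.

Lemma mittenpunkt_spieker_bounds (A B C : point) : nondegenerate A B C ->
  1 * D A B C 3 9 <= D A B C 3 10 /\ 1 / 2 * D A B C 3 10 <= D A B C 3 9.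
Proof.
  intros H.
  split; apply D_compare; try exact H; try lra;
    try (unfold affine_index, decreasing_index; tauto);
    intros x Hx; assert (h6 := sigma6_denominator_pos x); unfold sigma; apply le_of_sub_nonneg.
  - replace (_ - _) with ((1 - x) * (1 + x) / (2 * (3 + x))) by (field; lra).
    apply Rle_mult_inv_pos; nra.
  - replace (_ - _) with ((1 - x) ^ 2 / (4 * (3 + x))) by (field; lra).
    apply Rle_mult_inv_pos; nra.
Qed.

Lemma incenter_symmedian_bounds (A B C : point) : nondegenerate A B C ->
  (sqrt 3 - 1) * D A B C 3 6 <= D A B C 3 1 /\ 1 * D A B C 3 1 <= D A B C 3 6.
Proof.
  intros H.
  assert (h3 : sqrt 3 ^ 2 = 3) by (apply pow2_sqrt; lra).
  assert (h1 : 1 <= sqrt 3) by (rewrite <- sqrt_1; apply sqrt_le_1; lra).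
  split; apply D_compare; try exact H; try lra;
    try (unfold affine_index, decreasing_index; tauto);
    intros x Hx; assert (h6 := sigma6_denominator_pos x); unfold sigma; apply le_of_sub_nonneg.
  (* The constant is the minimum of [sigma 1 / sigma 6], reached at x = 2 - sqrt 3; hence the
     square. *)
  - replace (_ - _) with ((x + sqrt 3 - 2) ^ 2 / (3 - 2 * x + x ^ 2)).
    + apply Rle_mult_inv_pos; [apply pow2_ge_0 | lra].
    + replace ((x + sqrt 3 - 2) ^ 2)
        with (x ^ 2 + sqrt 3 ^ 2 + 4 + 2 * x * sqrt 3 - 4 * x - 4 * sqrt 3) by ring.
      rewrite h3. field; lra.
  - replace (_ - _) with ((1 - x) * (1 + x) / (3 - 2 * x + x ^ 2)) by (field; lra).
    apply Rle_mult_inv_pos; nra.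
Qed.

Lemma incenter_gergonne_bounds (A B C : point) : nondegenerate A B C ->
  1 / 17 * (7 + 4 * sqrt 2) * D A B C 3 7 <= D A B C 3 1 /\ 1 * D A B C 3 1 <= D A B C 3 7.
Proof.
  intros H.
  assert (h2 : sqrt 2 ^ 2 = 2) by (apply pow2_sqrt; lra).
  assert (h0 := sqrt_pos 2).
  split; apply D_compare; try exact H; try lra;
    try (unfold affine_index, decreasing_index; tauto);
    intros x Hx; assert (h6 := sigma6_denominator_pos x); unfold sigma; apply le_of_sub_nonneg.
  - set (k := 1 / 17 * (7 + 4 * sqrt 2)).
    assert (hk : 0 < k) by (unfold k; lra).
    assert (Ek : 17 * k ^ 2 = 14 * k - 1).
    { unfold k. replace (17 * _ ^ 2) with ((49 + 56 * sqrt 2 + 16 * sqrt 2 ^ 2) / 17) by field.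
      rewrite h2; field. }
    replace (_ - _) with ((k * (3 + x) - k ^ 2 * (4 + x - x ^ 2)) / (k * (3 + x)))
      by (field; lra).
    apply Rle_mult_inv_pos; [| nra].
    (* The discriminant in [x] of the numerator vanishes by [Ek]. *)
    assert (h := pow2_ge_0 (k * x + (1 - k) / 2)). nra.
  - replace (_ - _) with ((1 - x) * (1 + x) / (3 + x)) by (field; lra).
    apply Rle_mult_inv_pos; nra.
Qed.

(** * Symmedian against Gergonne point: critical values of the ratio *)

(* [sigma 6 / sigma 7 = num / den], and [num' * den - num * den' = 4 * stationary]. *)
Definition num (x : R) : R := 12 - 2 * x - 2 * x ^ 2.
Definition den (x : R) : R := 12 - 5 * x - x ^ 2 + 3 * x ^ 3 - x ^ 4.
Definition stationary (x : R) : R := 9 - 6 * x - 25 * x ^ 2 + 15 * x ^ 3 - x ^ 5.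

Lemma den_pos (x : R) : -1 < x < 1 -> 0 < den x.
Proof.
  intros Hx. replace (den x) with ((3 - 2 * x + x ^ 2) * (4 + x - x ^ 2)) by (unfold den; ring).
  apply Rmult_lt_0_compat; nra.
Qed.

Lemma quintic_stationary (x : R) : -1 < x < 1 -> stationary x = 0 ->
  quintic (num x / den x) = 0.
Proof.
  intros Hx Hs. assert (hd := den_pos x Hx).
  apply (Rmult_eq_reg_r (den x ^ 5)); [| apply pow_nonzero; lra].
  rewrite Rmult_0_l.
  (* The square appears because each critical value is attained to second order; the
     cofactor comes from polynomial division. *)
  transitivity (stationary x ^ 2 *
    (-221184 + 27648 * x + 230400 * x ^ 2 - 50672 * x ^ 3 - 27672 * x ^ 4 + 20788 * x ^ 5
     - 20732 * x ^ 6 + 856 * x ^ 7 + 5104 * x ^ 8 - 1500 * x ^ 9 + 100 * x ^ 10));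
    [| rewrite Hs; ring].
  transitivity (6137 * num x ^ 5 - 14689 * num x ^ 4 * den x + 14429 * num x ^ 3 * den x ^ 2
    - 9547 * num x ^ 2 * den x ^ 3 + 3698 * num x * den x ^ 4 - 100 * den x ^ 5).
  - unfold quintic; field; lra.
  - unfold num, den, stationary; ring.
Qed.

(** At a critical point [x0] of num / den with value [c], the quartic c den - num vanishes together
    with its derivative ([P0] and [P1]), so (x - x0)^2 splits off; the last factor is the
    quotient. *)
Lemma double_root (x0 x c : R) : -1 < x0 < 1 -> stationary x0 = 0 -> c = num x0 / den x0 ->
  c * den x - num x
  = (x - x0) ^ 2 * (- c * x ^ 2 + (3 - 2 * x0) * c * x + (2 - c + 6 * x0 * c - 3 * x0 ^ 2 * c)).
Proof.
  intros Hx Hs Hc. assert (hd := den_pos x0 Hx).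
  assert (P0 : c * den x0 - num x0 = 0) by (rewrite Hc; field; lra).
  assert (P1 : c * (-5 - 2 * x0 + 9 * x0 ^ 2 - 4 * x0 ^ 3) + 2 + 4 * x0 = 0).
  { apply (Rmult_eq_reg_r (den x0)); [| lra].
    transitivity (-4 * stationary x0); [| rewrite Hs; ring].
    rewrite Hc. unfold num, den, stationary in *. field. lra. }
  match goal with |- _ = ?rhs =>
    transitivity (rhs + (c * den x0 - num x0)
      + (x - x0) * (c * (-5 - 2 * x0 + 9 * x0 ^ 2 - 4 * x0 ^ 3) + 2 + 4 * x0)) end.
  - unfold den, num; ring.
  - rewrite P0, P1; ring.
Qed.

Lemma sigma_6_7 (k l x : R) : -1 < x < 1 ->
  (k * num x <= l * den x -> k * sigma 6 x <= l * sigma 7 x) /\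
  (l * den x <= k * num x -> l * sigma 7 x <= k * sigma 6 x).
Proof.
  intros Hx. assert (h6 := sigma6_denominator_pos x).
  assert (E : l * sigma 7 x - k * sigma 6 x
    = (l * den x - k * num x) * / ((3 - 2 * x + x ^ 2) * (3 + x))).
  { unfold sigma, num, den; field; lra. }
  assert (hp : 0 < / ((3 - 2 * x + x ^ 2) * (3 + x))) by (apply Rinv_0_lt_compat, Rmult_lt_0_compat; lra).
  split; intros h; nra.
Qed.

(** * Locating the roots of [stationary] and of the quintic *)

Lemma stationary_continuous : continuity stationary.
Proof. unfold stationary; reg. Qed.

Lemma quintic_continuous : continuity quintic.
Proof. unfold quintic; reg. Qed.

(** The divided difference of the quintic: where it keeps a strict sign, two roots must coincide. *)
Definition slope (x y : R) : R :=
  6137 * (x ^ 4 + x ^ 3 * y + x ^ 2 * y ^ 2 + x * y ^ 3 + y ^ 4)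
  - 14689 * (x ^ 3 + x ^ 2 * y + x * y ^ 2 + y ^ 3)
  + 14429 * (x ^ 2 + x * y + y ^ 2) - 9547 * (x + y) + 3698.

Lemma quintic_increment (x y : R) : quintic x - quintic y = (x - y) * slope x y.
Proof. unfold quintic, slope; ring. Qed.

Lemma slope_neg (x y : R) : 0.89 <= x <= 1.05 -> 0.9002 <= y <= 0.9003 -> slope x y < 0.
Proof.
  intros Hx Hy.
  replace x with (0.89 + (x - 0.89)) by ring. replace y with (0.9002 + (y - 0.9002)) by ring.
  assert (hu : 0 <= x - 0.89 <= 0.16) by lra. assert (hv : 0 <= y - 0.9002 <= 0.0001) by lra.
  set (u := x - 0.89) in *. set (v := y - 0.9002) in *. clearbody u v.
  (* Measured from a corner of the box, each monomial is bounded separately, which makes the goal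
     linear. *)
  assert (M : forall m n : nat, 0 <= u ^ m * v ^ n <= 0.16 ^ m * 0.0001 ^ n).
  { intros m n.
    assert (hum := pow_incr u 0.16 m hu). assert (hvn := pow_incr v 0.0001 n hv).
    assert (0 <= u ^ m) by (apply pow_le; lra). assert (0 <= v ^ n) by (apply pow_le; lra).
    split; [apply Rmult_le_pos | apply Rmult_le_compat]; assumption. }
  unfold slope.
  assert (m10 := M 1%nat 0%nat). assert (m20 := M 2%nat 0%nat).
  assert (m30 := M 3%nat 0%nat). assert (m40 := M 4%nat 0%nat).
  assert (m01 := M 0%nat 1%nat). assert (m11 := M 1%nat 1%nat).
  assert (m21 := M 2%nat 1%nat). assert (m31 := M 3%nat 1%nat).
  assert (m02 := M 0%nat 2%nat). assert (m12 := M 1%nat 2%nat).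
  assert (m22 := M 2%nat 2%nat). assert (m03 := M 0%nat 3%nat).
  assert (m13 := M 1%nat 3%nat). assert (m04 := M 0%nat 4%nat).
  clear M. lra.
Qed.

Lemma slope_pos (x y : R) : 1.05 <= x -> 1.05 <= y -> 0 < slope x y.
Proof.
  intros Hx Hy.
  replace x with (1.05 + (x - 1.05)) by ring. replace y with (1.05 + (y - 1.05)) by ring.
  assert (hu : 0 <= x - 1.05) by lra. assert (hv : 0 <= y - 1.05) by lra.
  set (u := x - 1.05) in *. set (v := y - 1.05) in *. clearbody u v.
  (* Centred at 1.05, [slope] has a positive constant term and nonnegative coefficients. *)
  assert (M : forall m n : nat, 0 <= u ^ m * v ^ n)
    by (intros; apply Rmult_le_pos; apply pow_le; assumption).
  unfold slope.
  assert (m10 := M 1%nat 0%nat). assert (m20 := M 2%nat 0%nat).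
  assert (m30 := M 3%nat 0%nat). assert (m40 := M 4%nat 0%nat).
  assert (m01 := M 0%nat 1%nat). assert (m11 := M 1%nat 1%nat).
  assert (m21 := M 2%nat 1%nat). assert (m31 := M 3%nat 1%nat).
  assert (m02 := M 0%nat 2%nat). assert (m12 := M 1%nat 2%nat).
  assert (m22 := M 2%nat 2%nat). assert (m03 := M 0%nat 3%nat).
  assert (m13 := M 1%nat 3%nat). assert (m04 := M 0%nat 4%nat).
  clear M. lra.
Qed.

Lemma root_unique_low (x y : R) : quintic x = 0 -> quintic y = 0 ->
  0.89 <= x <= 1.05 -> 0.9002 <= y <= 0.9003 -> x = y.
Proof.
  intros Hx Hy hx hy. assert (E := quintic_increment x y).
  assert (h := slope_neg x y hx hy). rewrite Hx, Hy, Rminus_diag in E.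
  symmetry in E. apply Rmult_integral in E. destruct E; lra.
Qed.

Lemma root_unique_high (x y : R) : quintic x = 0 -> quintic y = 0 ->
  1.05 <= x -> 1.05 <= y -> x = y.
Proof.
  intros Hx Hy hx hy. assert (E := quintic_increment x y).
  assert (h := slope_pos x y hx hy). rewrite Hx, Hy, Rminus_diag in E.
  symmetry in E. apply Rmult_integral in E. destruct E; lra.
Qed.

Lemma root_between (f : R -> R) (x y : R) :
  continuity f -> x < y -> f x * f y < 0 -> exists z : R, x <= z <= y /\ f z = 0.
Proof.
  intros Hf Hxy H. destruct (IVT_cor f x y Hf) as (z & Hz); [lra | lra | exists z; exact Hz].
Qed.

Lemma quintic_roots : exists C1 C2 : R, quintic C1 = 0 /\ quintic C2 = 0 /\
  0.9002270329 <= C1 <= 0.9002270331 /\ 1.100851118 <= C2 <= 1.100851120.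
Proof.
  assert (Hc : continuity quintic) by (unfold quintic; reg).
  destruct (root_between quintic 0.9002270329 0.9002270331) as (C1 & H1 & R1);
    [exact Hc | lra | unfold quintic; lra |].
  destruct (root_between quintic 1.100851118 1.100851120) as (C2 & H2 & R2);
    [exact Hc | lra | unfold quintic; lra |].
  exists C1, C2. tauto.
Qed.

Lemma stationary_roots : exists x1 x2 : R, stationary x1 = 0 /\ stationary x2 = 0 /\
  -0.62 <= x1 <= -0.6 /\ 0.57 <= x2 <= 0.59.
Proof.
  assert (Hc : continuity stationary) by (unfold stationary; reg).
  destruct (root_between stationary (-0.62) (-0.6)) as (x1 & H1 & R1);
    [exact Hc | lra | unfold stationary; lra |].
  destruct (root_between stationary 0.57 0.59) as (x2 & H2 & R2);
    [exact Hc | lra | unfold stationary; lra |].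
  exists x1, x2. tauto.
Qed.

(** * The sharp bounds C1 and C2 *)

Lemma symmedian_gergonne_lower (c : R) (A B C : point) : 0.9002 <= c <= 0.9003 ->
  (forall z : R, quintic z = 0 -> 0.89 <= z <= 1.05 -> z = c) -> nondegenerate A B C ->
  c * D A B C 3 7 <= D A B C 3 6.
Proof.
  intros hc Hc H. destruct stationary_roots as (x0 & _ & Hs & _ & Hx & _).
  assert (hx : -1 < x0 < 1) by lra. assert (hd := den_pos x0 hx).
  (* A coarse bracket for the critical value identifies it, since [c] is the only root in that
     bracket. *)
  assert (Ec : c = num x0 / den x0).
  { symmetry. apply Hc; [apply quintic_stationary; assumption |].
    split; apply (Rmult_le_reg_r (den x0)); try exact hd;
      replace (num x0 / den x0 * den x0) with (num x0) by (field; lra);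
      unfold num, den.
    - nra.
    - nra. }
  apply D_compare; [lra | unfold decreasing_index; tauto | | exact H].
  intros x h. rewrite <- (Rmult_1_l (sigma 6 x)). apply (sigma_6_7 1 c x h).
  assert (E := double_root x0 x c hx Hs Ec).
  assert (h2 := pow2_ge_0 (x - x0)).
  (* The cofactor [q] is c times this expression plus 2, and 0.9002 * 2.4 > 2. *)
  assert (hq : - x ^ 2 + (3 - 2 * x0) * x + (- 1 + 6 * x0 - 3 * x0 ^ 2) <= -2.4) by nra.
  set (q := - c * x ^ 2 + _ + _) in E.
  assert (hq' : q <= 0) by (unfold q; nra). nra.
Qed.

Lemma symmedian_gergonne_upper (c : R) (A B C : point) : 1.05 <= c ->
  (forall z : R, quintic z = 0 -> 1.05 <= z -> z = c) -> nondegenerate A B C ->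
  1 * D A B C 3 6 <= c * D A B C 3 7.
Proof.
  intros hc Hc H. destruct stationary_roots as (_ & x0 & _ & Hs & _ & Hx).
  assert (hx : -1 < x0 < 1) by lra. assert (hd := den_pos x0 hx).
  assert (hb : 1.05 * den x0 <= num x0 <= 1.2 * den x0).
  { unfold num, den; split; nra. }
  assert (Ec : c = num x0 / den x0).
  { symmetry. apply Hc; [apply quintic_stationary; assumption |].
    apply (Rmult_le_reg_r (den x0)); [exact hd |].
    replace (num x0 / den x0 * den x0) with (num x0) by (field; lra). lra. }
  assert (hc2 : c <= 1.2).
  { apply (Rmult_le_reg_r (den x0)); [exact hd |].
    rewrite Ec; replace (num x0 / den x0 * den x0) with (num x0) by (field; lra). lra. }
  (* [D_compare] takes a factor on the smaller side only, hence the division by [c]. *)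
  apply (Rmult_le_reg_l (/ c)); [apply Rinv_0_lt_compat; lra |].
  replace (/ c * (c * D A B C 3 7)) with (D A B C 3 7) by (field; lra).
  rewrite Rmult_1_l.
  apply D_compare; [left; apply Rinv_0_lt_compat; lra | unfold decreasing_index; tauto | | exact H].
  intros x h.
  apply (Rmult_le_reg_l c); [lra |].
  replace (c * (/ c * sigma 6 x)) with (1 * sigma 6 x) by (field; lra).
  apply (sigma_6_7 1 c x h).
  assert (E := double_root x0 x c hx Hs Ec).
  assert (h2 := pow2_ge_0 (x - x0)).
  (* Again [q] is c times this expression plus 2, and 1.2 * 1.5 < 2. *)
  assert (hq : -1.5 <= - x ^ 2 + (3 - 2 * x0) * x + (- 1 + 6 * x0 - 3 * x0 ^ 2)) by nra.
  set (q := - c * x ^ 2 + _ + _) in E.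
  assert (hq' : 0 <= q) by (unfold q; nra). nra.
Qed.

(** * The table of bounds *)

Theorem theorem3 :
  exists C1 C2 : R,
    is_second_largest_root quintic C1 /\
    is_largest_root quintic C2 /\
    Rabs (C1 - 0.9002270330) <= 0.0000000001 /\
    Rabs (C2 - 1.100851119) <= 0.000000001 /\
    forall A B C : point, nondegenerate A B C ->
      (* D(3,1) *)
      1 * D A B C 3 2 <= D A B C 3 1 <= 3 * D A B C 3 2 /\
      1 / 3 * D A B C 3 4 <= D A B C 3 1 <= 1 * D A B C 3 4 /\
      2 / 3 * D A B C 3 5 <= D A B C 3 1 <= 2 * D A B C 3 5 /\
      (sqrt 3 - 1) * D A B C 3 6 <= D A B C 3 1 <= 1 * D A B C 3 6 /\
      1 / 17 * (7 + 4 * sqrt 2) * D A B C 3 7 <= D A B C 3 1 <= 1 * D A B C 3 7 /\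
      1 * D A B C 3 8 <= D A B C 3 1 /\
      1 * D A B C 3 9 <= D A B C 3 1 /\
      1 * D A B C 3 10 <= D A B C 3 1 /\
      (* D(3,2) *)
      D A B C 3 2 = 1 / 3 * D A B C 3 4 /\
      D A B C 3 2 = 2 / 3 * D A B C 3 5 /\
      1 / 3 * D A B C 3 6 <= D A B C 3 2 <= 1 * D A B C 3 6 /\
      1 / 3 * D A B C 3 7 <= D A B C 3 2 <= 1 * D A B C 3 7 /\
      1 / 3 * D A B C 3 8 <= D A B C 3 2 /\
      1 * D A B C 3 9 <= D A B C 3 2 /\
      1 * D A B C 3 10 <= D A B C 3 2 /\
      (* D(3,4) *)
      D A B C 3 4 = 2 * D A B C 3 5 /\
      1 * D A B C 3 6 <= D A B C 3 4 <= 3 * D A B C 3 6 /\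
      1 * D A B C 3 7 <= D A B C 3 4 <= 3 * D A B C 3 7 /\
      1 * D A B C 3 8 <= D A B C 3 4 /\
      3 * D A B C 3 9 <= D A B C 3 4 /\
      3 * D A B C 3 10 <= D A B C 3 4 /\
      (* D(3,5) *)
      1 / 2 * D A B C 3 6 <= D A B C 3 5 <= 3 / 2 * D A B C 3 6 /\
      1 / 2 * D A B C 3 7 <= D A B C 3 5 <= 3 / 2 * D A B C 3 7 /\
      1 / 2 * D A B C 3 8 <= D A B C 3 5 /\
      3 / 2 * D A B C 3 9 <= D A B C 3 5 /\
      3 / 2 * D A B C 3 10 <= D A B C 3 5 /\
      (* D(3,6) *)
      C1 * D A B C 3 7 <= D A B C 3 6 <= C2 * D A B C 3 7 /\
      1 * D A B C 3 8 <= D A B C 3 6 /\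
      1 * D A B C 3 9 <= D A B C 3 6 /\
      1 * D A B C 3 10 <= D A B C 3 6 /\
      (* D(3,7) *)
      1 * D A B C 3 8 <= D A B C 3 7 /\
      1 * D A B C 3 9 <= D A B C 3 7 /\
      1 * D A B C 3 10 <= D A B C 3 7 /\
      (* D(3,9) *)
      1 / 2 * D A B C 3 10 <= D A B C 3 9 <= 1 * D A B C 3 10.
Proof.
  destruct quintic_roots as (C1 & C2 & R1 & R2 & H1 & H2).
  assert (B1 : 0.9002 <= C1 <= 0.9003) by lra.
  assert (B2 : 1.05 <= C2) by lra.
  assert (HC2 : forall z : R, quintic z = 0 -> 1.05 <= z -> z = C2)
    by (intros z Hz hz; apply (root_unique_high z C2); assumption).
  assert (HC1 : forall z : R, quintic z = 0 -> 0.89 <= z <= 1.05 -> z = C1)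
    by (intros z Hz hz; apply (root_unique_low z C1); assumption).
  exists C1, C2.
  split; [split; [exact R1 |] |].
  (* A root above [C1] but below 1.05 would equal [C1], so only [C2] is larger. *)
  { exists C2. split; [split; [exact R2 | lra] |].
    intros z [Hz hz]. symmetry. apply HC2; [exact Hz |].
    destruct (Rle_dec 1.05 z) as [h | h]; [exact h | exfalso].
    assert (z = C1) by (apply HC1; [exact Hz | lra]). lra. }
  split.
  { split; [exact R2 |]. intros z Hz.
    destruct (Rle_dec 1.05 z) as [h | h]; [right; apply HC2; assumption | lra]. }
  split; [apply Rabs_le; lra |]. split; [apply Rabs_le; lra |].
  intros A B C H.
  destruct (euler_line A B C H).
  destruct (centroid_bounds A B C H) as (? & ? & ? & ? & ?).
  destruct (mittenpunkt_spieker_bounds A B C H).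
  destruct (incenter_symmedian_bounds A B C H).
  destruct (incenter_gergonne_bounds A B C H).
  assert (H18 := D_1_8 A B C H).
  assert (HL := symmedian_gergonne_lower C1 A B C B1 HC1 H).
  assert (HU := symmedian_gergonne_upper C2 A B C B2 HC2 H).
  assert (0 <= D A B C 3 1) by apply dist_nonneg.
  (* Writing Dn for D(3,n), the other bounds follow from the chains D9 <= D10 <= D2 <= D1 <= D6, D7
     <= 3 D2 and D8 <= D1, with D4 = 3 D2 = 2 D5. *)
  repeat split; lra.
Qed.
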